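(* For central variables $x,y$, the operator series satisfy $$B(y)A(x)=\frac{1}{1-xy}A(x)B(y).$$
   Context: $\beta$ is a scalar; $\mathbb{Z}[\beta]P$ is the free $\mathbb{Z}[\beta]$-module with basis all partitions (Young diagrams, columns indexed $1,2,\ldots$ from the left). For $i\ge1$, $u_i\cdot\lambda$ is obtained by adding a box in column $i$ and $d_i\cdot\lambda$ by removing a box from column $i$ (each $0$ if the result is not a partition). $\widetilde u_i=u_i(1-\beta d_i)$, $\widetilde d_i=(1-\beta d_i)^{-1}d_i=\sum_{k\ge1}\beta^{k-1}d_i^k$, $A(x)=\cdots(1+x\widetilde u_2)(1+x\widetilde u_1)$, $B(y)=(1+y\widetilde d_1)(1+y\widetilde d_2)\cdots$. *)

(* Defs.v *)
From HB Require Import structures.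
From mathcomp Require Import all_boot all_order all_algebra finmap.
From mathcomp.multinomials Require Import freeg.
From mathcomp Require Import boolp classical_sets.

Set Implicit Arguments.
Unset Strict Implicit.
Unset Printing Implicit Defensive.

Import GRing.Theory.

Local Open Scope fset_scope.
Local Open Scope ring_scope.

(* Cells are pairs (row, column), both numbered from 1; a partition is
   identified with its Young diagram. *)
Definition young (D : {fset nat * nat}) : bool :=
  all (fun c : nat * nat =>
         [&& (0 < c.1)%N, (0 < c.2)%N,
             (1 < c.1)%N ==> ((c.1.-1, c.2) \in D) &
             (1 < c.2)%N ==> ((c.1, c.2.-1) \in D)]) D.

Notation Partition := {D : {fset nat * nat} | young D}.

Definition col_height (i : nat) (la : Partition) : nat :=
  #|` [fset c in val la | c.2 == i]|.

(* A box added to (removed from) column i can only go to (come from) the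
   bottom of that column; None when the result is not a partition. *)
Definition add_box (i : nat) (la : Partition) : option Partition :=
  insub (((col_height i la).+1, i) |` val la).

Definition rem_box (i : nat) (la : Partition) : option Partition :=
  if col_height i la == 0%N then None
  else insub (val la `\ (col_height i la, i)).

Notation Zbeta := {poly int}.
Notation beta := ('X : Zbeta).
Notation ZbetaP := {freeg Partition / Zbeta}.

Definition basis_or0 (o : option Partition) : ZbetaP :=
  if o is Some la then << la >> else 0.

(* fglift is the linear extension of a map defined on the basis. *)
Definition u (i : nat) : ZbetaP -> ZbetaP :=
  fglift (fun la => basis_or0 (add_box i la)).

Definition d (i : nat) : ZbetaP -> ZbetaP :=
  fglift (fun la => basis_or0 (rem_box i la)).

(* Limit of an eventually constant sequence (0 if there is none). *)
Definition stable_lim (f : nat -> ZbetaP) : ZbetaP :=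
  xget 0 [set w | exists N, forall n, (N <= n)%N -> f n = w].

Definition ut (i : nat) (v : ZbetaP) : ZbetaP := u i (v - beta *: d i v).

Definition dt (i : nat) (v : ZbetaP) : ZbetaP :=
  stable_lim (fun n => \sum_(1 <= k < n.+1) beta ^+ k.-1 *: iter k (d i) v).

(* Formal power series in commuting variables x, y, central with respect to
   the operators: S a b is the coefficient of x^a y^b. *)
Definition opseries : Type := nat -> nat -> ZbetaP -> ZbetaP.

Definition opmul (F G : opseries) : opseries := fun a b v =>
  \sum_(i < a.+1) \sum_(j < b.+1) F i j (G (a - i)%N (b - j)%N v).

Definition opone : opseries := fun a b v =>
  if (a == 0%N) && (b == 0%N) then v else 0.

Definition one_plus_x (T : ZbetaP -> ZbetaP) : opseries := fun a b v =>
  match a, b with 0%N, 0%N => v | 1%N, 0%N => T v | _, _ => 0 end.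

Definition one_plus_y (T : ZbetaP -> ZbetaP) : opseries := fun a b v =>
  match a, b with 0%N, 0%N => v | 0%N, 1%N => T v | _, _ => 0 end.

Definition one_minus_xy : opseries := fun a b v =>
  match a, b with 0%N, 0%N => v | 1%N, 1%N => - v | _, _ => 0 end.

Definition inv_one_minus_xy : opseries := fun a b v =>
  if a == b then v else 0.

Definition oplim (F : nat -> opseries) : opseries := fun a b v =>
  stable_lim (fun n => F n a b v).

Fixpoint A_partial (n : nat) : opseries :=
  if n is m.+1 then opmul (one_plus_x (ut m.+1)) (A_partial m) else opone.

Fixpoint B_partial (n : nat) : opseries :=
  if n is m.+1 then opmul (B_partial m) (one_plus_y (dt m.+1)) else opone.

Definition A : opseries := oplim A_partial.
Definition B : opseries := oplim B_partial.

(* The remainder of the file shows that every limit above exists, that dt i is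
   (1 - beta d_i)^-1 d_i, and that inv_one_minus_xy inverts one_minus_xy. *)

Lemma stable_limE (f : nat -> ZbetaP) (w : ZbetaP) (N : nat) :
  (forall n, (N <= n)%N -> f n = w) -> stable_lim f = w.
Proof.
move=> fw; rewrite /stable_lim; case: xgetP => [z _ [M fz]|]; last first.
  by move=> /(_ w) /= []; exists N.
by rewrite -(fz (maxn M N)) ?leq_maxl // (fw (maxn M N)) ?leq_maxr.
Qed.

Section Extension.
Variable f : Partition -> ZbetaP.

Lemma fgliftE (v : ZbetaP) :
  fglift f v = \sum_(la <- dom v) coeff la v *: f la.
Proof.
have fB := lift_is_additive f.
have f0 : fglift f 0 = 0 by have := fB 0 0; rewrite !subrr.
have fN x : fglift f (- x) = - fglift f x by rewrite -[- x]add0r fB f0 add0r.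
have fD x y : fglift f (x + y) = fglift f x + fglift f y.
  by rewrite -{1}[y]opprK fB fN opprK.
rewrite -{1}(freeg_sumE v) (big_morph (fglift f) fD f0).
by apply: eq_bigr => la _; rewrite liftU.
Qed.

Lemma fglift_linear : linear (fglift f).
Proof.
move=> c x y.
pose s := undup (dom x ++ dom y).
have E z : {subset dom z <= s} -> fglift f z = \sum_(la <- s) coeff la z *: f la.
  move=> sz; rewrite fgliftE [RHS](bigID (fun la => la \in dom z)) /=.
  rewrite [X in _ = _ + X]big1 ?addr0; last first.
    by move=> la la_z; rewrite coeff_outdom ?scale0r.
  rewrite -[RHS]big_filter; apply/perm_big/uniq_perm.
  - exact: uniq_dom.
  - by rewrite filter_uniq // undup_uniq.
  - by move=> la; rewrite mem_filter; case: (boolP (la \in dom z)) => // /sz.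
have sx : {subset dom x <= s}.
  by move=> la; rewrite mem_undup mem_cat => ->.
have sy : {subset dom y <= s}.
  by move=> la; rewrite mem_undup mem_cat => ->; rewrite orbT.
rewrite !E //; last first.
  move=> la /domD_subset; rewrite mem_cat => /orP[/domZ_subset|].
    exact: sx.
  exact: sy.
rewrite scaler_sumr -big_split /=; apply: eq_bigr => la _.
by rewrite coeffD coeffZ scalerDl scalerA.
Qed.
End Extension.

HB.instance Definition _ i := GRing.isLinear.Build Zbeta ZbetaP ZbetaP _ (u i)
  (fglift_linear (fun la => basis_or0 (add_box i la))).
HB.instance Definition _ i := GRing.isLinear.Build Zbeta ZbetaP ZbetaP _ (d i)
  (fglift_linear (fun la => basis_or0 (rem_box i la))).

Section Young.
Variables (D : {fset nat * nat}) (yD : young D).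

Lemma young_gt0 r c : (r, c) \in D -> (0 < r)%N && (0 < c)%N.
Proof. by move=> /(allP yD) /= /and4P[-> ->]. Qed.

Lemma young_up r r' c : (r, c) \in D -> (0 < r' <= r)%N -> (r', c) \in D.
Proof.
elim: r => [|r IH] rD /andP[r'0]; first by rewrite leqNgt r'0.
rewrite leq_eqVlt => /orP[/eqP -> //|]; rewrite ltnS => r'r.
apply: IH; last by rewrite r'0.
have /and4P[_ _ /implyP H _] := allP yD _ rD.
by apply: H; rewrite ltnS (leq_trans r'0).
Qed.

Lemma young_left r c c' : (r, c) \in D -> (0 < c' <= c)%N -> (r, c') \in D.
Proof.
elim: c => [|c IH] rD /andP[c'0]; first by rewrite leqNgt c'0.
rewrite leq_eqVlt => /orP[/eqP -> //|]; rewrite ltnS => c'c.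
apply: IH; last by rewrite c'0.
have /and4P[_ _ _ /implyP H] := allP yD _ rD.
by apply: H; rewrite ltnS (leq_trans c'0).
Qed.

Lemma young_size r c : (r, c) \in D -> (c <= #|` D|)%N.
Proof.
move=> rcD; rewrite -[c in (c <= _)%N](size_iota 1) -(size_map (pair r)).
apply: uniq_leq_size.
  by rewrite map_inj_uniq ?iota_uniq // => x y [].
move=> x /mapP[j]; rewrite mem_iota add1n ltnS => j1c ->.
exact: young_left rcD j1c.
Qed.
End Young.

Definition psize (la : Partition) : nat := #|` val la|.

Lemma col_heightP i la : (0 < col_height i la)%N ->
  (col_height i la, i) \in val la.
Proof.
set h := col_height i la => h0; apply/negP => /negP hN.
suff : (h <= h.-1)%N by rewrite leqNgt ltn_predL h0.
rewrite -[h.-1](size_iota 1) -(size_map (pair^~ i)).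
apply: uniq_leq_size => [|[r c]]; first exact: fset_uniq.
rewrite !inE /= => /andP[rD /eqP ci]; rewrite {c}ci in rD *.
apply: map_f; rewrite mem_iota add1n prednK //.
have /andP[-> _] /= := young_gt0 (valP la) rD.
rewrite ltnNge; apply: contra hN => hr.
by apply: (young_up (valP la) rD); rewrite h0.
Qed.

Lemma add_box_size i la mu :
  add_box i la = Some mu -> (psize mu <= (psize la).+1)%N.
Proof.
rewrite /add_box; case: insubP => // mu' _ muE [<-].
by rewrite /psize muE cardfsU1 -[X in (_ <= X)%N]add1n leq_add2r leq_b1.
Qed.

Lemma add_box_None i la : ((psize la).+1 < i)%N -> add_box i la = None.
Proof.
move=> lai; rewrite /add_box; case: insubP => // mu ymu muE.
have := @young_size _ ymu (col_height i la).+1 i; rewrite fset1U1 => /(_ isT).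
rewrite leqNgt; case/negP; apply: leq_ltn_trans lai.
by rewrite cardfsU1 -[X in (_ <= X)%N]add1n leq_add2r leq_b1.
Qed.

Lemma rem_box_size i la mu :
  rem_box i la = Some mu -> (psize mu < psize la)%N.
Proof.
rewrite /rem_box; case: eqP => // /eqP; rewrite -lt0n => /col_heightP hD.
case: insubP => // mu' _ muE [<-].
by rewrite /psize muE [X in (_ < X)%N](cardfsD1 (col_height i la, i)) hD.
Qed.

Lemma rem_box_None i la : (psize la < i)%N -> rem_box i la = None.
Proof.
move=> lai; rewrite /rem_box; case: eqP => // /eqP.
rewrite -lt0n => /col_heightP /(young_size (valP la)).
by rewrite leqNgt lai.
Qed.

(* The submodule spanned by the partitions of at most s boxes. *)
Definition bounded (s : nat) (v : ZbetaP) : Prop :=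
  forall la, la \in dom v -> (psize la <= s)%N.

Lemma bounded_ex v : exists s, bounded s v.
Proof.
exists (\max_(la <- dom v) psize la)%N => la lav.
by rewrite (big_rem la) //= leq_maxl.
Qed.

Lemma bounded0 s : bounded s 0.
Proof. by move=> la; rewrite dom0. Qed.

Lemma boundedD s v w : bounded s v -> bounded s w -> bounded s (v + w).
Proof.
move=> bv bw la /domD_subset; rewrite mem_cat => /orP[/bv|/bw] //.
Qed.

Lemma boundedZ s c v : bounded s v -> bounded s (c *: v).
Proof. by move=> bv la /domZ_subset /bv. Qed.

Lemma boundedN s v : bounded s v -> bounded s (- v).
Proof. by move=> bv; rewrite -scaleN1r; exact: boundedZ. Qed.

Lemma boundedW s t v : (s <= t)%N -> bounded s v -> bounded t v.
Proof. by move=> st bv la /bv /leq_trans; apply. Qed.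

Lemma bounded_sum s (I : Type) (r : seq I) (F : I -> ZbetaP) :
  (forall i, bounded s (F i)) -> bounded s (\sum_(i <- r) F i).
Proof.
move=> bF; elim/big_rec: _ => [|i x _ bx]; first exact: bounded0.
exact: boundedD.
Qed.

Lemma bounded_fglift s t f v :
  (forall la, (psize la <= s)%N -> bounded t (f la)) ->
  bounded s v -> bounded t (fglift f v).
Proof.
move=> bf bv; rewrite fgliftE big_seq.
elim/big_rec: _ => [|la x /bv /bf bla bx]; first exact: bounded0.
by apply: boundedD => //; apply: boundedZ.
Qed.

Lemma fglift_eq0 s (f : Partition -> ZbetaP) v :
  (forall la, (psize la <= s)%N -> f la = 0) -> bounded s v -> fglift f v = 0.
Proof.
move=> f0 bv; rewrite fgliftE big_seq big1 // => la /bv /f0 ->.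
by rewrite scaler0.
Qed.

Lemma bounded_basis s la : (psize la <= s)%N -> bounded s << la >>.
Proof. by move=> las mu; rewrite domU1 inE => /eqP ->. Qed.

Lemma bounded_u s i v : bounded s v -> bounded s.+1 (u i v).
Proof.
apply: bounded_fglift => la las; case E: (add_box i la) => [mu|] /=.
  by apply: bounded_basis; apply: leq_trans (add_box_size E) _.
exact: bounded0.
Qed.

Lemma bounded_d s i v : bounded s v -> bounded s.-1 (d i v).
Proof.
apply: bounded_fglift => la las; case E: (rem_box i la) => [mu|] /=.
  apply: bounded_basis; have := leq_trans (rem_box_size E) las.
  by case: (s).
exact: bounded0.
Qed.

Lemma bounded_dW s i v : bounded s v -> bounded s (d i v).
Proof. by move=> /(bounded_d (i := i)); exact/boundedW/leq_pred. Qed.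

Lemma u_eq0 s i v : bounded s v -> (s.+1 < i)%N -> u i v = 0.
Proof.
move=> bv si; apply: fglift_eq0 bv => la las.
by rewrite add_box_None //; apply: leq_trans si.
Qed.

Lemma d_eq0 s i v : bounded s v -> (s < i)%N -> d i v = 0.
Proof.
move=> bv si; apply: fglift_eq0 bv => la las.
by rewrite rem_box_None //; apply: leq_trans si.
Qed.

Lemma iter_d_eq0 s i k v : bounded s v -> (s < k)%N -> iter k (d i) v = 0.
Proof.
elim: k s v => // k IH s v bv sk; rewrite iterSr.
case: s bv sk => [|s] bv sk; last exact: (IH s _ (bounded_d bv)).
suff -> : d i v = 0.
  by elim: (k) => //= m ->; rewrite raddf0.
apply: (fglift_eq0 _ bv) => la; rewrite leqn0 => /eqP la0.
by case E: (rem_box i la) => [mu|] //; have := rem_box_size E; rewrite la0.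
Qed.

Lemma dtE s i v : bounded s v ->
  dt i v = \sum_(1 <= k < s.+1) beta ^+ k.-1 *: iter k (d i) v.
Proof.
move=> bv; apply: (@stable_limE _ _ s) => n sn.
rewrite (big_cat_nat _ (n := s.+1)) //= [X in _ + X](_ : _ = 0) ?addr0 //.
rewrite big_nat big1 // => k /andP[sk _].
by rewrite (iter_d_eq0 _ bv) ?scaler0.
Qed.

Lemma dt_inverse i v : dt i v - beta *: d i (dt i v) = d i v.
Proof.
have [s bv] := bounded_ex v; rewrite (dtE i (boundedW (leqnSn s) bv)).
rewrite [d i (\sum_(_ <= _ < _) _)]linear_sum scaler_sumr /=.
rewrite big_nat_recl // [X in _ - X]big_nat_recr //=.
rewrite [d i (_ *: d i _)]linearZ /= -!iterS (iter_d_eq0 _ bv) //.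
rewrite !scaler0 addr0 expr0 scale1r -addrA [X in _ + X](_ : _ = 0) ?addr0 //.
apply/eqP; rewrite subr_eq0; apply/eqP.
by apply: eq_big_nat => -[|k] // _; rewrite linearZ scalerA -exprS.
Qed.

Lemma opmul_one_plus_x T G a b v :
  opmul (one_plus_x T) G a b v =
    G a b v + (if a is a'.+1 then T (G a' b v) else 0).
Proof.
rewrite /opmul big_ord_recl big_ord_recl /= !subn0.
rewrite [X in G a b v + X + _]big1 // addr0; congr (_ + _).
case: a => [|a]; first by rewrite big_ord0.
rewrite big_ord_recl big_ord_recl /= subSS !subn0.
rewrite [X in T _ + X + _]big1 // addr0 big1 ?addr0 // => i _.
by rewrite big1.
Qed.

Lemma opmul_one_plus_y T F a b v : (forall i j, F i j 0 = 0) ->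
  opmul F (one_plus_y T) a b v =
    F a b v + (if b is b'.+1 then F a b' (T v) else 0).
Proof.
move=> F0; rewrite /opmul big_ord_recr /= subnn big1 ?add0r; last first.
  move=> i _; rewrite big1 // => j _; have := ltn_ord i; rewrite -subn_gt0.
  by case: (a - i)%N => // k _; rewrite F0.
rewrite big_ord_recr /= subnn addrC; congr (_ + _).
case: b => [|b]; first by rewrite big_ord0.
rewrite big_ord_recr /= subSnn big1 ?add0r // => j _.
have := ltn_ord j; rewrite -subn_gt0 subSn; last exact/ltnW.
by case: (b - j)%N => // k _; rewrite F0.
Qed.

Lemma bounded_ut s i v : bounded s v -> bounded s.+1 (ut i v).
Proof.
by move=> bv; apply/bounded_u/boundedD/boundedN/boundedZ/bounded_dW.
Qed.

Lemma ut_eq0 s i v : bounded s v -> (s.+1 < i)%N -> ut i v = 0.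
Proof.
move=> bv; apply: u_eq0.
by apply/boundedD/boundedN/boundedZ/bounded_dW.
Qed.

Lemma dt_eq0 s i v : bounded s v -> (s < i)%N -> dt i v = 0.
Proof.
move=> bv si; rewrite (dtE i bv) big_nat big1 // => -[|k] // _.
rewrite iterSr (d_eq0 bv si) [iter _ _ _](_ : _ = 0) ?scaler0 //.
by elim: k => //= k ->; rewrite raddf0.
Qed.

Lemma bounded_A_partial s n a b v :
  bounded s v -> bounded (s + a) (A_partial n a b v).
Proof.
move=> bv; elim: n a => [|n IH] a /=.
  rewrite /opone; case: ifP => _; last exact: bounded0.
  exact/boundedW/bv/leq_addr.
rewrite opmul_one_plus_x; apply: boundedD => //.
case: a => [|a]; first exact: bounded0.
by rewrite addnS; apply: bounded_ut.
Qed.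

Lemma A_partial_stable s a b v n :
  bounded s v -> (s + a < n)%N -> A_partial n a b v = A a b v.
Proof.
move=> bv san.
have stable m : (s + a < m)%N -> A_partial m a b v = A_partial n a b v.
  suff E k : A_partial ((s + a).+1 + k) a b v = A_partial (s + a).+1 a b v.
    by move=> sam; rewrite -(subnKC san) -(subnKC sam) !E.
  elim: k => [|k IH]; first by rewrite addn0.
  have sak := leq_addr k (s + a).+1; rewrite addnS; move: ((_ + k)%N) IH sak.
  move=> k1 IH sam /=; rewrite opmul_one_plus_x IH.
  case: a {san IH} sam => [|a]; rewrite ?addr0 // addnS => sam.
  by rewrite (ut_eq0 (@bounded_A_partial s _ _ _ _ bv)) ?addr0 // ltnW.
by rewrite /A /oplim (@stable_limE _ _ (s + a).+1 stable).
Qed.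

Lemma B_partial0 n a b : B_partial n a b 0 = 0.
Proof.
elim: n a b => [|n IH] a b /=; first by rewrite /opone if_same.
rewrite opmul_one_plus_y // IH add0r; case: b => [|b] //.
by rewrite (@dt_eq0 0%N) //; exact: bounded0.
Qed.

Lemma B_partial_stable s a b v n :
  bounded s v -> (s <= n)%N -> B_partial n a b v = B a b v.
Proof.
move=> bv sn.
have stable m : (s <= m)%N -> B_partial m a b v = B_partial n a b v.
  suff E k : B_partial (s + k) a b v = B_partial s a b v.
    by move=> sm; rewrite -(subnKC sn) -(subnKC sm) !E.
  elim: k => [|k IH]; first by rewrite addn0.
  rewrite addnS /= (opmul_one_plus_y _ _ _ _ (B_partial0 _)) IH.
  by case: b {IH} => [|b]; rewrite ?(dt_eq0 bv) ?B_partial0 ?addr0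
    // ltnS leq_addr.
by rewrite /B /oplim (@stable_limE _ _ s stable).
Qed.

Lemma mul_inv_one_minus_xy :
  opmul one_minus_xy inv_one_minus_xy = opone.
Proof.
apply/funext => a; apply/funext => b; apply/funext => v.
rewrite /opmul /inv_one_minus_xy /opone big_ord_recl big_ord_recl /= !subn0.
rewrite [X in _ + X + _]big1 // addr0.
case: a => [|a]; first by rewrite big_ord0 addr0 eq_sym.
rewrite big_ord_recl /= subSS subn0 [X in _ + (_ + X)]big1 ?addr0; last first.
  by move=> i _; rewrite big1 // => -[[|[|j]]].
rewrite big_ord_recl /= add0r; case: b => [|b]; first by rewrite big_ord0 addr0.
rewrite big_ord_recl /= subSS subn0 big1 ?addr0 // eqSS.
by case: eqP => _; rewrite ?subrr ?subr0.
Qed.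

Lemma inv_mul_one_minus_xy :
  opmul inv_one_minus_xy one_minus_xy = opone.
Proof.
rewrite -mul_inv_one_minus_xy.
apply/funext => a; apply/funext => b; apply/funext => v; rewrite /opmul.
rewrite (reindex_inj rev_ord_inj) /=; apply: eq_bigr => i _.
rewrite (reindex_inj rev_ord_inj) /=; apply: eq_bigr => j _.
rewrite !subSS !subKn; try by rewrite -ltnS.
rewrite /inv_one_minus_xy /one_minus_xy.
by case: (val i) (val j) => [|[|?]] [|[|?]]; case: ifP => //; rewrite oppr0.
Qed.

(* Main.v *)
(* Let A_n, B_n be the partial products, p_n the projection on the partitions
   with a removable box in column n (p_0 = 1), and q_n = 1 - p_n.  Then
     A_n B_n = B_n (1 - xy q_n) A_n
   by induction on n, using p_n = u_n d_n = d_(n+1) u_(n+1) and the relations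
   d u d = d, u d u = u, from which
     ut_(n+1) dt_(n+1) = p_(n+1),
     dt_(n+1) ut_(n+1) = p_n - beta dt_(n+1) q_n,
     A_n dt_(n+1) = dt_(n+1) (1 - x beta q_n) A_n,
   while B_n commutes with ut_(n+1).  On a fixed vector each coefficient of
   q_n A_n equals that of A_n for n large, so that AB = (1 - xy) BA. *)
Require Import Defs.
From HB Require Import structures.
From mathcomp Require Import all_boot all_order all_algebra finmap.
From mathcomp.multinomials Require Import freeg.
From mathcomp Require Import boolp classical_sets zify.

Set Implicit Arguments.
Unset Strict Implicit.
Unset Printing Implicit Defensive.

Import GRing.Theory.

Local Open Scope fset_scope.
Local Open Scope ring_scope.

(** * Partitions and box moves in terms of column heights *)

Lemma mem_partition (la : Partition) r c :
  ((r, c) \in val la) = (0 < r <= col_height c la)%N.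
Proof.
apply/idP/idP => [rcD|/andP[r0 rh]]; last first.
  by apply: (young_up (valP la) (col_heightP (leq_trans r0 rh))); rewrite r0.
have /andP[r0 _] := young_gt0 (valP la) rcD.
rewrite r0 /= -[r](size_iota 1) -(size_map (pair^~ c)).
apply: uniq_leq_size; first by rewrite map_inj_uniq ?iota_uniq // => x y [].
move=> x /mapP[j]; rewrite mem_iota add1n ltnS => j1r ->.
by rewrite !inE /= eqxx andbT (young_up (valP la) rcD j1r).
Qed.

Lemma col_height_count i (la : Partition) h :
  (forall r, ((r, i) \in val la) = (0 < r <= h)%N) -> col_height i la = h.
Proof.
move=> laE; apply/eqP; rewrite eqn_leq; apply/andP; split.
  case E: (col_height i la) => [//|k]; have := laE k.+1.
  by rewrite mem_partition E ltnSn.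
case: h laE => // k /(_ k.+1); rewrite ltnSn mem_partition.
by case/andP.
Qed.

Lemma partition_eq (la mu : Partition) :
  (forall i, col_height i la = col_height i mu) -> la = mu.
Proof.
move=> lamu; apply/val_inj/fsetP => -[r c].
by rewrite !mem_partition lamu.
Qed.

Lemma col_height0 (la : Partition) : col_height 0 la = 0%N.
Proof.
case E: (col_height 0 la) => [//|k]; have : (1%N, 0%N) \in val la.
  by rewrite mem_partition E.
by move=> /(young_gt0 (valP la)) /andP[].
Qed.

Lemma col_heightS (la : Partition) i :
  (col_height i.+2 la <= col_height i.+1 la)%N.
Proof.
case E: (col_height i.+2 la) => [//|k].
have : (k.+1, i.+2) \in val la by rewrite mem_partition E leqnn.
move=> /(young_left (valP la)) => /(_ i.+1); rewrite leqnSn.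
by move=> /(_ isT); rewrite mem_partition => /andP[].
Qed.

Lemma youngI (D : {fset nat * nat}) (h : nat -> nat) :
  h 0%N = 0%N -> (forall i, h i.+2 <= h i.+1)%N ->
  (forall r c, ((r, c) \in D) = (0 < r <= h c)%N) -> young D.
Proof.
move=> h0 hS DE; apply/allP => -[r c]; rewrite DE /= => /andP[r0 rh].
apply/and4P; split=> //.
- by case: c rh => //; rewrite h0; case: r r0.
- by apply/implyP => r1; rewrite DE; lia.
apply/implyP => c1; rewrite DE r0 (leq_trans rh) //.
by case: c c1 {rh} => [|[|c]].
Qed.

(** Column 0 has height 0 here, although it should never obstruct adding a box in column 1; hence
    the separate case [i == 1]. *)
Definition addable i (la : Partition) :=
  (i == 1%N) || (col_height i la < col_height i.-1 la)%N.

Definition removable i (la : Partition) :=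
  (col_height i.+1 la < col_height i la)%N.

(** Describing the result by its heights alone turns later identities between box moves into linear
    arithmetic. *)
Variant add_box_spec i (la : Partition) : option Partition -> Prop :=
| AddBoxSome mu of addable i la
    & (forall j, col_height j mu = col_height j la + (j == i))%N :
    add_box_spec i la (Some mu)
| AddBoxNone of ~~ addable i la : add_box_spec i la None.

Variant rem_box_spec i (la : Partition) : option Partition -> Prop :=
| RemBoxSome mu of removable i la
    & (forall j, col_height j mu = col_height j la - (j == i))%N :
    rem_box_spec i la (Some mu)
| RemBoxNone of ~~ removable i la : rem_box_spec i la None.

Lemma add_boxP i la : (0 < i)%N -> add_box_spec i la (add_box i la).
Proof.
move=> i0; rewrite /add_box.
have mE r c : ((r, c) \in ((col_height i la).+1, i) |` val la)
    = (0 < r <= col_height c la + (c == i))%N.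
  rewrite !inE mem_partition xpair_eqE; case: (c =P i) => [->|_]; lia.
case: insubP => [mu ymu muE|/negP ny].
  apply: AddBoxSome => [|j]; last first.
    by apply: col_height_count => r; rewrite muE mE.
  rewrite /addable; case: i i0 mE muE ymu => [//|[//|i]] _ mE muE ymu /=.
  have : ((col_height i.+2 la).+1, i.+2) \in val mu by rewrite muE fset1U1.
  move=> /(young_left (valP mu)) => /(_ i.+1); rewrite leqnSn.
  by move=> /(_ isT); rewrite muE mE; lia.
apply: AddBoxNone; apply/negP => addi; apply: ny.
apply: (youngI _ _ mE) => [|j]; first by rewrite col_height0; lia.
have := col_heightS la j; move: addi; rewrite /addable.
case: (j.+2 =P i) => [<-|]; case: (j.+1 =P i) => /=; lia.
Qed.

Lemma rem_boxP i la : (0 < i)%N -> rem_box_spec i la (rem_box i la).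
Proof.
move=> i0; rewrite /rem_box; case: eqP => [h0|hN0].
  by apply: RemBoxNone; rewrite /removable h0.
have mE r c : ((r, c) \in val la `\ (col_height i la, i))
    = (0 < r <= col_height c la - (c == i))%N.
  rewrite !inE mem_partition xpair_eqE; case: (c =P i) => [->|_]; lia.
case: insubP => [mu ymu muE|/negP ny].
  have hE j : (col_height j mu = col_height j la - (j == i))%N.
    by apply: col_height_count => r; rewrite muE mE.
  apply: RemBoxSome => //; rewrite /removable.
  case: i i0 hN0 mE muE ymu hE => // i _ hN0 mE muE ymu hE.
  by have := col_heightS mu i; rewrite !hE; lia.
apply: RemBoxNone; apply/negP => remi; apply: ny.
apply: (youngI _ _ mE) => [|j]; first by rewrite col_height0.
have := col_heightS la j; move: remi; rewrite /removable.
by case: (j.+1 =P i) => [<-|]; case: (j.+2 =P i) => /=; lia.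
Qed.

(** * Relations between the operators [u] and [d] *)

Lemma u_basis_or0 i o : u i (basis_or0 o) = basis_or0 (obind (add_box i) o).
Proof.
case: o => [la|] /=; last exact: raddf0.
by rewrite /u liftU scale1r.
Qed.

Lemma d_basis_or0 i o : d i (basis_or0 o) = basis_or0 (obind (rem_box i) o).
Proof.
case: o => [la|] /=; last exact: raddf0.
by rewrite /d liftU scale1r.
Qed.

Lemma linear_ext (F G : {linear ZbetaP -> ZbetaP}) :
  (forall la, F << la >> = G << la >>) -> F =1 G.
Proof.
move=> FG v; rewrite -(freeg_sumE v) !raddf_sum /=; apply: eq_bigr => la _.
have -> : << coeff la v *g la >> = coeff la v *: << la >> :> ZbetaP.
  by apply/eqP/freeg_eqP => mu; rewrite coeffZ !coeffU mul1r.
by rewrite !linearZ /= FG.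
Qed.

Ltac box_lia :=
  unfold addable, removable in *;
  repeat match goal with
  | H : forall j, col_height j ?m = _, G : context[col_height ?k ?m] |- _ =>
      rewrite (H k) in G
  | H : forall j, col_height j ?m = _ |- context[col_height ?k ?m] =>
      rewrite (H k)
  end;
  simpl in *; lia.

(** The possible outcomes of a case split: the two sides agree outright, the addability and
    removability conditions are contradictory, or the two resulting partitions have equal heights in
    every column. *)
Ltac box_solve :=
  first
  [ by []
  | exfalso; box_lia
  | congr (basis_or0 (Some _)); apply: partition_eq;
    let k := fresh "k" in intro k;
    repeat match goal with
    | H : forall j, col_height j ?m = _ |- context[col_height k ?m] =>
        rewrite (H k)
    end;
    repeat (case: (k =P _) => ?); subst; box_lia ].

(** For [j = i.+1] either order demands that column [i] exceed column [j] by at least two; otherwise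
    neither move affects the condition for the other. *)
Lemma d_u_comm i j v : (0 < i)%N -> (0 < j)%N -> i != j ->
  d i (u j v) = u j (d i v).
Proof.
move=> i0 j0 ij; move: v; apply: (@linear_ext (d i \o u j) (u j \o d i)) => la /=.
rewrite -[<<la>>]/(basis_or0 (Some la)) !(u_basis_or0, d_basis_or0) /=.
have [ji|ji] := eqVneq j i.+1; [subst j|];
case: (add_boxP la j0) => [mu addj hmu|addj];
  case: (rem_boxP la i0) => [nu remi hnu|remi] //=;
  try (case: (rem_boxP mu i0) => [mu' remi' hmu'|remi']);
  try (case: (add_boxP nu j0) => [nu' addj' hnu'|addj']); box_solve.
Qed.

(** Removability in column [i] depends only on columns [i] and [i.+1], so one column in between
    keeps the two moves independent; adjacent columns would interfere. *)
Lemma d_d_comm i j v : (0 < i)%N -> (i.+1 < j)%N -> d i (d j v) = d j (d i v).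
Proof.
move=> i0 ij; have j0 : (0 < j)%N by lia.
move: v; apply: (@linear_ext (d i \o d j) (d j \o d i)) => la /=.
rewrite -[<<la>>]/(basis_or0 (Some la)) !d_basis_or0 /=.
case: (rem_boxP la j0) => [mu remj hmu|remj];
  case: (rem_boxP la i0) => [nu remi hnu|remi] //=;
  try (case: (rem_boxP mu i0) => [mu' remi' hmu'|remi']);
  try (case: (rem_boxP nu j0) => [nu' remj' hnu'|remj']); box_solve.
Qed.

Lemma d1_u1 v : d 1 (u 1 v) = v.
Proof.
move: v; apply: (@linear_ext (d 1 \o u 1) idfun) => la /=.
rewrite -[<<la>>]/(basis_or0 (Some la)) u_basis_or0 d_basis_or0 /=.
have := col_heightS la 0.
case: (add_boxP la (ltn0Sn 0)) => [mu add1 hmu|add1] /=;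
  try (case: (rem_boxP mu (ltn0Sn 0)) => [nu rem1 hnu|rem1]) => h21; box_solve.
Qed.

(** Column [i.+1] can take a box exactly when column [i] can lose one, so both sides are the
    projection on the partitions with a removable box in column [i]. *)
Lemma dS_uS i v : (0 < i)%N -> d i.+1 (u i.+1 v) = u i (d i v).
Proof.
move=> i0; move: v; apply: (@linear_ext (d i.+1 \o u i.+1) (u i \o d i)) => la /=.
rewrite -[<<la>>]/(basis_or0 (Some la)) !(u_basis_or0, d_basis_or0) /=.
(* Monotone heights make an added box removable again and a removed box addable again. *)
have := col_heightS la i.-1; have := col_heightS la i.
case: i i0 => [//|[|i]] i0; [|have := col_heightS la i];
case: (add_boxP la (ltn0Sn _)) => [mu add1 hmu|add1] /=;
  case: (rem_boxP la i0) => [nu rem1 hnu|rem1] //=;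
  try (case: (rem_boxP mu (ltn0Sn _)) => [mu' rem' hmu'|rem']);
  try (case: (add_boxP nu i0) => [nu' add' hnu'|add']) => *; box_solve.
Qed.

Lemma d_u_d i v : (0 < i)%N -> d i (u i (d i v)) = d i v.
Proof.
move=> i0; move: v; apply: (@linear_ext (d i \o u i \o d i) (d i)) => la /=.
rewrite -[<<la>>]/(basis_or0 (Some la)) !(u_basis_or0, d_basis_or0) /=.
case: (rem_boxP la i0) => [mu rem1 hmu|rem1] //=.
case: i i0 rem1 hmu => [//|[|i]] i0 rem1 hmu;
  [have hi := col_heightS la 0|have hi := col_heightS la i];
case: (add_boxP mu i0) => [nu add1 hnu|add1] //=;
  try (case: (rem_boxP nu i0) => [nu' rem2 hnu'|rem2]); box_solve.
Qed.

Lemma u_d_u i v : (0 < i)%N -> u i (d i (u i v)) = u i v.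
Proof.
move=> i0; move: v; apply: (@linear_ext (u i \o d i \o u i) (u i)) => la /=.
rewrite -[<<la>>]/(basis_or0 (Some la)) !(u_basis_or0, d_basis_or0) /=.
case: (add_boxP la i0) => [mu add1 hmu|add1] //=.
case: i i0 add1 hmu => [//|[|i]] i0 add1 hmu;
  [have hi := col_heightS la 0|have hi := col_heightS la i.+1];
case: (rem_boxP mu i0) => [nu rem1 hnu|rem1] //=;
  try (case: (add_boxP nu i0) => [nu' add2 hnu'|add2]); box_solve.
Qed.

(** * The operators [dt] and [ut] and the projections *)

(** The difference [z] satisfies [z = beta d z], hence [z = beta^k d^k z] for all [k], and [d i] is
    nilpotent on partitions of bounded size. *)
Lemma one_sub_d_inj i v w :
  v - beta *: d i v = w - beta *: d i w -> v = w.
Proof.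
move=> vw; apply/eqP; rewrite -subr_eq0; apply/eqP; set z := v - w.
have zE : z = beta *: d i z.
  apply/eqP; rewrite -subr_eq0 /z linearB scalerBr opprD addrACA vw.
  by rewrite -opprD subrr.
have [s bz] := bounded_ex z.
have zk k : z = beta ^+ k *: iter k (d i) z.
  elim: k => [|k IH]; first by rewrite expr0 scale1r.
  by rewrite {1}zE {1}IH linearZ scalerA exprS.
by rewrite (zk s.+1) (iter_d_eq0 _ bz) ?scaler0.
Qed.

(** Replaces the limit in [dt] by a single equation, from which later identities for [dt] are
    derived. *)
Lemma dt_unique i v w : w - beta *: d i w = d i v -> dt i v = w.
Proof. by move=> dw; apply: (@one_sub_d_inj i); rewrite dt_inverse. Qed.

Lemma dt_linear i : linear (dt i).
Proof.
move=> c v w; apply: dt_unique; rewrite !linearP /=.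
rewrite -(dt_inverse i v) -(dt_inverse i w) !scalerDr !scalerN.
by rewrite addrACA.
Qed.

HB.instance Definition _ i :=
  GRing.isLinear.Build Zbeta ZbetaP ZbetaP _ (dt i) (dt_linear i).

Lemma ut_linear i : linear (ut i).
Proof.
move=> c v w; rewrite /ut -linearP; congr (u i _).
rewrite !linearP /= !scalerDr !scalerN.
by rewrite addrACA.
Qed.

HB.instance Definition _ i :=
  GRing.isLinear.Build Zbeta ZbetaP ZbetaP _ (ut i) (ut_linear i).

Lemma dt_comm (F : {linear ZbetaP -> ZbetaP}) i v :
  (forall w, d i (F w) = F (d i w)) -> dt i (F v) = F (dt i v).
Proof.
move=> dF; apply: dt_unique.
by rewrite dF -linearZ -linearB dt_inverse -dF.
Qed.

(* The projection on the partitions with a removable box in column [n], with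
   the convention that column [0] always has one. *)
Definition proj n (v : ZbetaP) : ZbetaP := d n.+1 (u n.+1 v).

Lemma proj_linear n : linear (proj n).
Proof. by move=> c v w; rewrite /proj !linearP. Qed.

HB.instance Definition _ n :=
  GRing.isLinear.Build Zbeta ZbetaP ZbetaP _ (proj n) (proj_linear n).

Definition coproj n (v : ZbetaP) : ZbetaP := v - proj n v.

Lemma coproj_linear n : linear (coproj n).
Proof. by move=> c v w; rewrite /coproj linearP scalerBr opprD addrACA. Qed.

HB.instance Definition _ n :=
  GRing.isLinear.Build Zbeta ZbetaP ZbetaP _ (coproj n) (coproj_linear n).

Lemma projS n v : proj n.+1 v = u n.+1 (d n.+1 v).
Proof. exact: dS_uS. Qed.

Lemma coproj0 v : coproj 0 v = 0.
Proof. by rewrite /coproj /proj d1_u1 subrr. Qed.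

Lemma proj_dS n v : proj n (d n.+1 v) = d n.+1 v.
Proof. exact: d_u_d. Qed.

Lemma proj_dtS n v : proj n (dt n.+1 v) = dt n.+1 v.
Proof.
(* The range of [dt] lies in that of [d], since [dt v = d v + beta d (dt v)]. *)
rewrite -{1}[dt _ v](subrK (beta *: d n.+1 (dt n.+1 v))) dt_inverse.
by rewrite linearD linearZ /= !proj_dS -(dt_inverse _ v) subrK.
Qed.

Lemma coproj_dtS n v : coproj n (dt n.+1 v) = 0.
Proof. by rewrite /coproj proj_dtS subrr. Qed.

Lemma coproj_uS n v : coproj n.+1 (u n.+1 v) = 0.
Proof. by rewrite /coproj projS u_d_u // subrr. Qed.

Lemma coproj_utS n v : coproj n.+1 (ut n.+1 v) = 0.
Proof. exact: coproj_uS. Qed.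

Lemma uS_coproj n v : u n.+1 (coproj n v) = 0.
Proof. by rewrite /coproj linearB /= /proj u_d_u // subrr. Qed.

Lemma dtS_coproj n v : dt n.+1 (coproj n.+1 v) = 0.
Proof.
apply: dt_unique.
by rewrite /coproj linear0 scaler0 subr0 linearB /= projS d_u_d // subrr.
Qed.

Lemma utE n v : ut n.+1 v = u n.+1 v - beta *: proj n.+1 v.
Proof. by rewrite /ut linearB linearZ /= projS. Qed.

Lemma utS_coproj n v :
  ut n.+1 (coproj n v) = - (beta *: proj n.+1 (coproj n v)).
Proof. by rewrite utE uS_coproj add0r. Qed.

Lemma ut_dt n v : ut n.+1 (dt n.+1 v) = proj n.+1 v.
Proof. by rewrite /ut dt_inverse projS. Qed.

(** Under [1 - beta d] in column [n.+1] both sides become [proj n v - beta *: d n.+1 v], because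
    [proj n] fixes the range of [d n.+1]. *)
Lemma dt_ut n v :
  dt n.+1 (ut n.+1 v) = proj n v - beta *: dt n.+1 (coproj n v).
Proof.
have dv : d n.+1 v = d n.+1 (proj n v) + d n.+1 (coproj n v).
  by rewrite -linearD /= addrC subrK.
apply: dt_unique; move: (dt_inverse n.+1 (coproj n v)) dv => <-.
set D := dt n.+1 _; set p := proj n v => dv.
rewrite /ut [u _ (_ - _)]linearB /= [u _ (_ *: _)]linearZ /=.
rewrite ![d _ (_ - _)]linearB /= ![d _ (_ *: _)]linearZ /=.
rewrite -[d _ (u _ v)]/p -[d _ (u _ (d _ v))]/(proj n (d n.+1 v)) proj_dS dv.
by rewrite !(scalerDr, scalerN, opprD) addrACA -addrA.
Qed.

(** * Coefficients of the partial products and their commutation relations *)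

(* Two zero coefficients are put in front, so that the recursion and the
   commutation relations need no boundary cases. *)
Definition Ac n a v := if a is a'.+2 then A_partial n a' 0 v else 0.
Definition Bc n b v := if b is b'.+2 then B_partial n 0 b' v else 0.

Lemma Ac01 n v : (Ac n 0 v = 0) * (Ac n 1 v = 0). Proof. by []. Qed.

Lemma Bc01 n v : (Bc n 0 v = 0) * (Bc n 1 v = 0). Proof. by []. Qed.

Lemma AcS n a v : Ac n.+1 a.+1 v = Ac n a.+1 v + ut n.+1 (Ac n a v).
Proof.
case: a => [|a] /=; first by rewrite linear0 addr0.
by rewrite opmul_one_plus_x; case: a => [|a] //=; rewrite linear0.
Qed.

Lemma BcS n b v : Bc n.+1 b.+1 v = Bc n b.+1 v + Bc n b (dt n.+1 v).
Proof.
case: b => [|b] /=; first by rewrite addr0.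
by rewrite (opmul_one_plus_y _ _ _ _ (B_partial0 _)); case: b.
Qed.

Lemma Ac_linear n a : linear (Ac n a).
Proof.
elim: n a => [|n IH] a c v w.
  by case: a => [|[|[|a]]]; rewrite /Ac /= /opone /= ?scaler0 ?addr0.
case: a => [|a]; first by rewrite /= scaler0 addr0.
by rewrite !AcS !IH linearP scalerDr addrACA.
Qed.

HB.instance Definition _ n a :=
  GRing.isLinear.Build Zbeta ZbetaP ZbetaP _ (Ac n a) (@Ac_linear n a).

Lemma Bc_linear n b : linear (Bc n b).
Proof.
elim: n b => [|n IH] b c v w.
  by case: b => [|[|[|b]]]; rewrite /Bc /= /opone /= ?scaler0 ?addr0.
case: b => [|b]; first by rewrite /= scaler0 addr0.
by rewrite !BcS linearP !IH scalerDr addrACA.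
Qed.

HB.instance Definition _ n b :=
  GRing.isLinear.Build Zbeta ZbetaP ZbetaP _ (Bc n b) (@Bc_linear n b).

Lemma Bc_comm (F : {linear ZbetaP -> ZbetaP}) n b v :
  (forall i w, (0 < i <= n)%N -> d i (F w) = F (d i w)) ->
  Bc n b (F v) = F (Bc n b v).
Proof.
elim: n b v => [|n IH] b v dF.
  by case: b => [|[|[|b]]] //=; rewrite /opone /= ?linear0.
have IHn b' w : Bc n b' (F w) = F (Bc n b' w).
  by apply: IH => i x /andP[i0 ni]; apply: dF; rewrite i0 ltnW.
case: b => [|b]; first by rewrite /= linear0.
rewrite !BcS linearD IHn dt_comm ?IHn // => w.
by apply: dF; rewrite ltnSn.
Qed.

(** Written as [d n.+2] after [u n.+2], the projection in [utE] stays two columns away from those of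
    [Bc n]; in the form [u n.+1] after [d n.+1] it would bring in the non-commuting pair [d n],
    [d n.+1]. *)
Lemma Bc_ut n b v : Bc n b (ut n.+1 v) = ut n.+1 (Bc n b v).
Proof.
rewrite !utE linearB linearZ; congr (_ - beta *: _); apply: Bc_comm => i w.
  by move=> /andP[i0 ni]; apply: d_u_comm => //; lia.
move=> /andP[i0 ni]; rewrite /proj d_d_comm; try lia.
by congr (d _ _); apply: d_u_comm => //; lia.
Qed.

Lemma Ac_dt n m a v : (n < m)%N -> Ac n a (dt m.+1 v) = dt m.+1 (Ac n a v).
Proof.
elim: n a => [|n IH] a nm.
  by case: a => [|[|[|a]]] //=; rewrite /opone /= ?linear0.
case: a => [|a]; first by rewrite /= linear0.
rewrite !AcS linearD !IH; try lia.
congr (_ + _); symmetry; apply: dt_comm => w; rewrite /ut d_u_comm; try lia.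
by congr (u _ _); rewrite linearB linearZ /= (@d_d_comm n.+1) //; lia.
Qed.

(** For [n > 0], [proj n] fixes the range of [dt n.+1], so there the last factor's [ut n] acts as
    [u n - beta], which commutes with [dt n.+1]; the [coproj] term is the difference between [ut n]
    and [u n - beta]. *)
Lemma Ac_dtS n a v :
  Ac n a.+1 (dt n.+1 v) = dt n.+1 (Ac n a.+1 v - beta *: coproj n (Ac n a v)).
Proof.
case: n => [|n].
  rewrite coproj0 scaler0 subr0.
  by case: a => [|[|a]] //=; rewrite /opone /= ?linear0.
(* The [ut] term of the last factor dies under [coproj]. *)
have qA : coproj n.+1 (Ac n.+1 a v) = coproj n.+1 (Ac n a v).
  by case: a => [|a] //; rewrite AcS [coproj _ (_ + _)]linearD /= coproj_utS addr0.
rewrite qA !AcS !Ac_dt //; set w := Ac n a v.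
rewrite -addrA linearD /=; congr (_ + _).
have -> : ut n.+1 w - beta *: coproj n.+1 w = u n.+1 w - beta *: w.
  by rewrite utE /coproj scalerBr opprB addrA subrK.
rewrite utE proj_dtS [dt _ (_ - _)]linearB /= [dt _ (_ *: _)]linearZ /=.
congr (_ - _).
by symmetry; apply: dt_comm => x; apply: d_u_comm => //; lia.
Qed.

Arguments Ac : simpl never.
Arguments Bc : simpl never.

Lemma Ac_Bc n a b v :
  Ac n a.+1 (Bc n b.+1 v)
    = Bc n b.+1 (Ac n a.+1 v) - Bc n b (coproj n (Ac n a v)).
Proof.
elim: n a b v => [|n IH] a b v.
  rewrite coproj0 linear0 subr0.
  by case: a => [|[|a]]; case: b => [|[|b]].
case: a => [|a]; first by rewrite !Ac01 !linear0 addr0.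
case: b => [|b]; first by rewrite !Bc01 linear0 subr0.
(* On [dt n.+1 v] the induction hypothesis loses its correction term: [Ac n] maps the range of
   [dt n.+1] into itself, and [coproj n] vanishes there. *)
have qA0 k w : coproj n (Ac n k (dt n.+1 w)) = 0.
  by case: k => [|k]; rewrite ?linear0 // Ac_dtS coproj_dtS.
have AB_dt k : Ac n k.+1 (Bc n b.+1 (dt n.+1 v)) =
    Bc n b.+1 (dt n.+1 (Ac n k.+1 v - beta *: coproj n (Ac n k v))).
  by rewrite IH qA0 linear0 subr0 Ac_dtS.
(* These are the terms carrying the new factor [ut n.+1] on the left. The two contributions
   [beta p_(n+1) q_n A_n], one from [utS_coproj] and one from [Ac_dtS], cancel. *)
have utAB : ut n.+1 (Ac n a.+1 (Bc n b.+2 v))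
      + ut n.+1 (Ac n a.+1 (Bc n b.+1 (dt n.+1 v))) =
    Bc n b.+2 (ut n.+1 (Ac n a.+1 v)) + Bc n b.+1 (proj n.+1 (Ac n a.+1 v)).
  rewrite AB_dt IH [ut _ (_ - _)]linearB /= -!Bc_ut utS_coproj ut_dt.
  rewrite [proj _ (Ac _ _ _ - _)]linearB /= [proj _ (_ *: _)]linearZ /=.
  rewrite linearN /= opprK [Bc _ _ (proj _ (Ac _ _ _) - _)]linearB /=.
  by rewrite addrACA subrr addr0.
rewrite [Bc n.+1 b.+2 v]BcS linearD /= !AcS addrACA utAB AB_dt IH.
rewrite !BcS [coproj _ (_ + _)]linearD /= coproj_utS addr0 dtS_coproj linear0.
rewrite addr0; move: (Ac n a.+2 v) (Ac n a.+1 v) {qA0 AB_dt utAB} => w1 w0.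
rewrite [Bc _ _ (w1 + _)]linearD /= -[_ - _ + _]addrA addrACA -[RHS]addrA.
congr (_ + _); rewrite -!(linearN (Bc n b.+1)) -!(linearD (Bc n b.+1)) /=.
(* With p for [proj] and q for [coproj], what remains is [dt (w1 - beta q_n w0) - q_n w0 + p_(n+1)
   w0 = dt (w1 + ut w0) - q_(n+1) w0], which follows from [dt_ut]. *)
congr (Bc n b.+1 _).
rewrite [dt _ (w1 - _)]linearB [dt _ (w1 + ut _ _)]linearD /=.
rewrite [dt _ (_ *: _)]linearZ /=.
rewrite dt_ut /coproj !opprB addrACA [proj n w0 + dt _ w1]addrC [- w0 - _]addrC.
by rewrite !addrA [LHS]addrAC.
Qed.

(** * Passage to the limit and the identity of power series *)

Lemma A_eq0 a b v : A a b.+1 v = 0.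
Proof.
have [s bv] := bounded_ex v; rewrite -(A_partial_stable _ bv (ltnSn _)).
move: (s + a).+1 => n; elim: n a => [|n IH] a /=; first by rewrite /opone andbF.
rewrite opmul_one_plus_x IH add0r; case: a => [|a] //.
by rewrite IH linear0.
Qed.

Lemma B_eq0 a b v : B a.+1 b v = 0.
Proof.
have [s bv] := bounded_ex v; rewrite -(B_partial_stable _ _ bv (leqnn _)).
elim: s b v {bv} => [|n IH] b v //=.
by rewrite (opmul_one_plus_y _ _ _ _ (B_partial0 _)) IH add0r; case: b.
Qed.

Lemma A_0 a b : A a b 0 = 0.
Proof.
case: b => [|b]; last exact: A_eq0.
rewrite -(A_partial_stable _ (@bounded0 0) (ltnSn _)).
exact: (linear0 (Ac (0 + a).+1 a.+2)).
Qed.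

Lemma B_0 a b : B a b 0 = 0.
Proof.
by rewrite -(B_partial_stable _ _ (@bounded0 0) (leqnn _)) B_partial0.
Qed.

Lemma opmul_BA a b v : opmul B A a b v = B 0 b (A a 0 v).
Proof.
rewrite /opmul big_ord_recl [X in _ + X]big1 ?addr0; last first.
  by move=> i _; rewrite big1 // => j _; rewrite B_eq0.
rewrite big_ord_recr /= subn0 subnn big1 ?add0r // => j _.
have := ltn_ord j; rewrite -subn_gt0; case: (b - j)%N => // k _.
by rewrite A_eq0 B_0.
Qed.

Lemma opmul_AB a b v : opmul A B a b v = A a 0 (B 0 b v).
Proof.
rewrite /opmul big_ord_recr /= big1 ?add0r; last first.
  move=> i _; rewrite big1 // => j _; have := ltn_ord i; rewrite -subn_gt0.
  by case: (a - i)%N => // k _; rewrite B_eq0 A_0.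
by rewrite big_ord_recl /= subn0 subnn big1 ?addr0 // => j _; rewrite A_eq0.
Qed.

(** The limit is reached in two stages: once [Ac n] has settled on [v], its value is one fixed
    vector, on which [Bc n] settles in turn. *)
Lemma Bc_Ac_stable a b v : exists N, forall n, (N <= n)%N ->
  Bc n b.+2 (Ac n a.+2 v) = B 0 b (A a 0 v).
Proof.
have [s bv] := bounded_ex v; have [t bA] := bounded_ex (A a 0 v).
exists (maxn (s + a).+1 t) => n; rewrite geq_max => /andP[san tn].
by rewrite /Ac (A_partial_stable _ bv san) /Bc (B_partial_stable _ _ bA tn).
Qed.

Lemma Ac_Bc_stable a b v : exists N, forall n, (N <= n)%N ->
  Ac n a.+2 (Bc n b.+2 v) = A a 0 (B 0 b v).
Proof.
have [s bv] := bounded_ex v; have [t bB] := bounded_ex (B 0 b v).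
exists (maxn s (t + a).+1) => n; rewrite geq_max => /andP[sn tan].
by rewrite /Bc (B_partial_stable _ _ bv sn) /Ac (A_partial_stable _ bB tan).
Qed.

(** The number of boxes in a coefficient of [A_n v] is bounded uniformly in [n], so for large [n]
    there is no box in column [n] to remove and [proj n] vanishes on it. *)
Lemma coproj_Ac_stable a v : exists N, forall n, (N <= n)%N ->
  coproj n (Ac n a v) = Ac n a v.
Proof.
have [s bv] := bounded_ex v.
case: a => [|[|a]]; [by exists 0%N => n _; rewrite Ac01 linear0..|].
exists (s + a).+1 => -[//|n] san; rewrite /coproj projS.
by rewrite (d_eq0 (@bounded_A_partial s _ _ _ _ bv) san) linear0 subr0.
Qed.

Lemma B_A_recursion a b v :
  B 0 b (A a 0 v) = A a 0 (B 0 b v) +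
    (if (a, b) is (a'.+1, b'.+1) then B 0 b' (A a' 0 v) else 0).
Proof.
have [N1 BA] := Bc_Ac_stable a b v; have [N2 AB] := Ac_Bc_stable a b v.
have [N3 qA] := coproj_Ac_stable a.+1 v.
have [N4 BA'] := Bc_Ac_stable a.-1 b.-1 v.
pose n := (N1 + N2 + N3 + N4)%N.
have {}AB := AB n ltac:(lia); have {}BA := BA n ltac:(lia).
have {}qA := qA n ltac:(lia); have {}BA' := BA' n ltac:(lia).
have := Ac_Bc n a.+1 b.+1 v; rewrite qA AB BA => ->; rewrite -addrA.
(* When [a] or [b] is 0 the correction term has index 1 in [Ac] or [Bc], a padding coefficient, and
   so vanishes. *)
case: a b {AB BA qA} BA' => [|a] [|b] /= BA'; rewrite ?Ac01 ?Bc01 ?linear0;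
  by rewrite ?BA' ?addNr !addr0.
Qed.

Theorem theorem5p2 : opmul B A = opmul inv_one_minus_xy (opmul A B).
Proof.
apply/funext => a; apply/funext => b; apply/funext => v.
rewrite opmul_BA /opmul.
under eq_bigr do under eq_bigr do rewrite -/(opmul A B _ _ v) opmul_AB.
rewrite /inv_one_minus_xy; elim: a b => [|a IH] b; rewrite B_A_recursion.
  by rewrite big_ord_recl big_ord0 big_ord_recl /= big1 ?addr0 ?subn0.
(* The row [i = 0] contributes only its entry [j = 0], the [AB] term of the recursion; the other
   rows, with both indices lowered, give the induction hypothesis. *)
rewrite big_ord_recl [X in _ = X + _]big_ord_recl /= !subn0.
rewrite [X in _ = _ + X + _]big1 // addr0.
congr (_ + _); case: b => [|b].
  by rewrite big1 // => i _; rewrite big_ord_recl big_ord0 addr0.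
rewrite IH; apply: eq_bigr => i _; rewrite [RHS]big_ord_recl /= add0r.
by apply: eq_bigr => j _; rewrite !subSS.
Qed.
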